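(* Let $\mathbf{k}$ be a field, $X=\{x_i\mid i\in I\}$ a well-ordered set, and let $[X^+]_\omega$ carry the deg-lex-center ordering. Let $Di[X]=Di\langle X\mid T\rangle$ be the free commutative dialgebra generated by $X$, where $T$ consists of all polynomials $[u]_m\vdash[v]_n-[v]_n\vdash[u]_m$ and $[u]_m\dashv[v]_n-[v]_n\dashv[u]_m$ with $[u]_m,[v]_n\in[X^+]_\omega$. Then: (i) $Di[X]=Di\langle X\mid S\rangle$ (i.e. $Id(T)=Id(S)$), where $S$ consists of the nonzero polynomials among $$[u]_m-\lfloor u\rfloor_m\ \ ([u]_m\in[X^+]_\omega,\ |u|=2),\qquad [v]_n-\lfloor v\rfloor_1\ \ ([v]_n\in[X^+]_\omega,\ |v|\ge3).$$ (ii) $S$ is a Gröbner-Shirshov basis in $Di\langle X\rangle$. (iii) The set $\lfloor X^+\rfloor_{1}\cup\lfloor X^+\rfloor_{2-2}$ is a $\mathbf{k}$-basis of the free commutative dialgebra $Di[X]$, where $\lfloor X^+\rfloor_{1}:=\{\lfloor v\rfloor_1\mid\lfloor v\rfloor\in\lfloor X^+\rfloor\}$ and $\lfloor X^+\rfloor_{2-2}:=\{\lfloor u\rfloor_2\mid\lfloor u\rfloor\in\lfloor X^+\rfloor,\ |u|=2\}$.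
   Context: Free dialgebra. A dialgebra over $\mathbf{k}$ is a $\mathbf{k}$-module with two $\mathbf{k}$-bilinear associative products $\vdash,\dashv$ satisfying $a\dashv(b\vdash c)=a\dashv(b\dashv c)$, $(a\dashv b)\vdash c=(a\vdash b)\vdash c$, $a\vdash(b\dashv c)=(a\vdash b)\dashv c$; it is commutative if both products are commutative. $X^+$ is the set of nonempty words on $X$, $X^*$ the set of all words including the empty one, $|u|$ the length of $u$. $[X^+]_\omega=\{[u]_m\mid u\in X^+,\ 1\le m\le |u|\}$ is the set of normal diwords (formal pairs $(u,m)$); $u$ is the associative word and $p([u]_m)=m$ the position of center. $Di\langle X\rangle$ is the $\mathbf{k}$-space with basis $[X^+]_\omega$ and products $[u]_m\vdash[v]_n=[uv]_{|u|+n}$, $[u]_m\dashv[v]_n=[uv]_m$ extended bilinearly; it is the free dialgebra on $X$ ($x\in X$ is identified with $[x]_1$). An ideal is a subspace closed under both products, on both sides, with arbitrary elements; $Id(S)$ is the ideal generated by $S$ and $Di\langle X\mid S\rangle=Di\langle X\rangle/Id(S)$. For $u\in X^+$, $\lfloor u\rfloor\in X^+$ is the word obtained by rearranging the letters of $u$ in non-decreasing order, $\lfloor X^+\rfloor$ is the set of all such sorted words, and $\lfloor u\rfloor_m$ is the normal diword with associative word $\lfloor u\rfloor$ and position of center $m$. A subset of $[X^+]_\omega$ is said to be a basis of a quotient if the images of its elements are distinct and form a basis. Orderings. The deg-lex ordering on $X^+$ compares words first by length and then lexicographically from the left. The deg-lex-center ordering on $[X^+]_\omega$: $[u]_m>[v]_n$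 iff $(u,m)>(v,n)$ lexicographically (words compared by deg-lex). For $0\ne f\in Di\langle X\rangle$: $\overline f$ is the leading (largest) normal diword of $f$, $lc(f)$ its coefficient, $lt(f)=lc(f)\overline f$, $\widetilde f$ the associative word of $\overline f$, $r_f=f-lt(f)$. By convention $0$ is smaller than every diword and every word, and $\overline 0=\widetilde 0=0$. $f\neq0$ is monic if $lc(f)=1$; a set is monic if all its elements are. $f\ne0$ is strong if $\widetilde f>\widetilde{r_f}$ (in particular if $r_f=0$). Normal $S$-diwords ($S$ monic). For $s\in S$, $a,b\in X^*$ put $P([asb])=\{n: 1\le n\le|a|\}\cup\{|a|+p(\overline s)\}\cup\{n:|a\widetilde s|<n\le|a\widetilde sb|\}$ if $s$ is strong, and $P([asb])=\{|a|+p(\overline s)\}$ if $s$ is not strong. For $l\in P([asb])$ the normal $S$-diword $[asb]_l$ is the element: $[a]_l\dashv s\dashv[b]_1$ if $l\le|a|$; $[a]_{|a|}\vdash s\dashv[b]_1$ if $l=|a|+p(\overline s)$; $[a]_{|a|}\vdash s\vdash[b]_{l-|a\widetilde s|}$ if $l>|a\widetilde s|$ (factors with empty word omitted). One has $\overline{[asb]_l}=[a\widetilde sb]_l$. Compositions of monic $f,g\in Di\langle X\rangle$ (same notation $[afb]_l$, $P$ used for single polynomials): 1) If $f$ is not strong: $x\dashv f$ for all $x\in X$ and $f\vdash[u]_{|u|}$ for all $u\in X^+$. 2) If $w=\widetilde f=a\widetilde gb$, $a,b\in X^*$: if $p(\overline f)\in P([agb])$, $f-[agb]_{p(\overline f)}$;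 if $p(\overline f)\notin P([agb])$ and both $f,g$ are strong, for every $x\in X$, $[xf]_1-[xagb]_1$ and $[fx]_{|wx|}-[agbx]_{|wx|}$. 3) If $w=\widetilde fb=a\widetilde g$, $a,b\in X^*$, $|\widetilde f|+|\widetilde g|>|w|$: if $P([fb])\cap P([ag])\ne\varnothing$, for every $m$ in it $[fb]_m-[ag]_m$; if $P([fb])\cap P([ag])=\varnothing$ and both $f,g$ are strong, for every $x\in X$, $[xfb]_1-[xag]_1$ and $[fbx]_{|wx|}-[agx]_{|wx|}$. $h$ is trivial modulo $S$ if $h=\sum\alpha_i[a_is_ib_i]_{m_i}$ is a finite sum with $\alpha_i\in\mathbf{k}$, $[a_is_ib_i]_{m_i}$ normal $S$-diwords and $\overline{[a_is_ib_i]_{m_i}}\le\overline h$. A monic set $S$ is a Gröbner-Shirshov basis in $Di\langle X\rangle$ if every composition of elements of $S$ is trivial modulo $S$. *)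

(* Defs.v *)
From HB Require Import structures.
From mathcomp Require Import all_boot all_order all_algebra.
From mathcomp Require Import finmap monalg.
From mathcomp Require Import boolp classical_sets.

Set Implicit Arguments.
Unset Strict Implicit.
Unset Printing Implicit Defensive.

Import Order.TTheory GRing.Theory.

Local Open Scope ring_scope.
Local Open Scope quotient_scope.
Local Open Scope classical_set_scope.

Reserved Notation "a ⊢ b" (at level 40, left associativity).
Reserved Notation "a ⊣ b" (at level 40, left associativity).

HB.mixin Record Lmodule_isDialgebra (k : fieldType) D of GRing.Lmodule k D := {
  dial_l : D -> D -> D;
  dial_r : D -> D -> D;
  dial_l_linearl : forall c, linear (fun a => dial_l a c);
  dial_l_linearr : forall a, linear (fun c => dial_l a c);
  dial_r_linearl : forall c, linear (fun a => dial_r a c);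
  dial_r_linearr : forall a, linear (fun c => dial_r a c);
  dial_lA : associative dial_l;
  dial_rA : associative dial_r;
  dial_rl : forall a b c, dial_r a (dial_l b c) = dial_r a (dial_r b c);
  dial_lr : forall a b c, dial_l (dial_r a b) c = dial_l (dial_l a b) c;
  dial_inner : forall a b c, dial_l a (dial_r b c) = dial_r (dial_l a b) c
}.

#[short(type="dialgebraType")]
HB.structure Definition Dialgebra (k : fieldType) :=
  {D of Lmodule_isDialgebra k D & GRing.Lmodule k D}.

Notation "a ⊢ b" := (dial_l a b) : ring_scope.
Notation "a ⊣ b" := (dial_r a b) : ring_scope.

Section Ideal.
Variables (k : fieldType) (D : dialgebraType k).

Definition is_ideal (I : set D) : Prop :=
  [/\ I 0,
      forall (c : k) f g, I f -> I g -> I (c *: f + g) &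
      forall f g, I f -> [/\ I (f ⊢ g), I (g ⊢ f), I (f ⊣ g) & I (g ⊣ f)]].

Definition Id (S : set D) : set D :=
  [set f | forall I, is_ideal I -> S `<=` I -> I f].

Lemma Id_ideal S : is_ideal (Id S).
Proof.
split=> [I [] //|c f g If Ig I idI SI|f g If].
  by case: (idI) => _ + _; apply; [apply: If | apply: Ig].
by split=> I idI SI; case: (idI) => _ _ /(_ f g (If I idI SI)) [].
Qed.

Definition Id_pred S : {pred D} := fun f => `[< Id S f >].

Lemma Id_predP S f : reflect (Id S f) (f \in Id_pred S).
Proof. exact: asboolP. Qed.

Lemma Id_zmod S : zmod_closed (Id_pred S).
Proof.
have [I0 Ilin _] := Id_ideal S.
split=> [|f g /Id_predP If /Id_predP Ig]; apply/Id_predP => //.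
by rewrite -scaleN1r addrC; apply: Ilin.
Qed.

HB.instance Definition _ S :=
  GRing.isZmodClosed.Build D (Id_pred S) (Id_zmod S).

End Ideal.

Section Quotient.
Variables (k : fieldType) (D : dialgebraType k) (S : set D).

Definition dquot := {ideal_quot (Id_pred S)}.

HB.instance Definition _ := GRing.Zmodule.on dquot.

Definition dproj (f : D) : dquot := \pi f.

Lemma dprojD : {morph dproj : f g / f + g}.
Proof. by move=> f g; rewrite /dproj !piE. Qed.

Lemma dprojP f g : Id S (f - g) <-> dproj f = dproj g.
Proof.
split=> [Ifg|/eqP].
  apply/eqP; rewrite /dproj -Quotient.idealrBE; exact/Id_predP.
by rewrite /dproj -Quotient.idealrBE => /Id_predP.
Qed.

Lemma dreprK q : dproj (repr q) = q.
Proof. exact: reprK. Qed.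

Definition dquot_scale (c : k) (q : dquot) : dquot := dproj (c *: repr q).
Definition dquot_l (p q : dquot) : dquot := dproj (repr p ⊢ repr q).
Definition dquot_r (p q : dquot) : dquot := dproj (repr p ⊣ repr q).

Let IZ c f : Id S f -> Id S (c *: f).
Proof. by have [I0 Il _] := Id_ideal S => If; rewrite -[_ *: _]addr0; exact: Il. Qed.

Let ID f g : Id S f -> Id S g -> Id S (f + g).
Proof. by have [_ Il _] := Id_ideal S => *; rewrite -[f]scale1r; exact: Il. Qed.

Lemma dproj_scale c f : dquot_scale c (dproj f) = dproj (c *: f).
Proof.
by apply/dprojP; rewrite -scalerBr; apply: IZ; apply/dprojP; rewrite dreprK.
Qed.

Let reprI f : Id S (repr (dproj f) - f).
Proof. by apply/dprojP; rewrite dreprK. Qed.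

Let lB (m : D -> D -> D) a b c : linear (m^~ c) -> m (a - b) c = m a c - m b c.
Proof. by move=> l; rewrite addrC -scaleN1r l scaleN1r addrC. Qed.

Let rB (m : D -> D -> D) a b c : linear (m c) -> m c (a - b) = m c a - m c b.
Proof. by move=> l; rewrite addrC -scaleN1r l scaleN1r addrC. Qed.

Lemma dproj_l f g : dquot_l (dproj f) (dproj g) = dproj (f ⊢ g).
Proof.
apply/dprojP; have [_ _ Im] := Id_ideal S.
set f' := repr _; set g' := repr _.
have -> : f' ⊢ g' - f ⊢ g = (f' - f) ⊢ g' + f ⊢ (g' - g).
  by rewrite (lB _ _ (@dial_l_linearl _ _ _)) (rB _ _ (@dial_l_linearr _ _ _)) addrA subrK.
by apply: ID; [case: (Im _ g' (reprI f)) | case: (Im _ f (reprI g))].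
Qed.

Lemma dproj_r f g : dquot_r (dproj f) (dproj g) = dproj (f ⊣ g).
Proof.
apply/dprojP; have [_ _ Im] := Id_ideal S.
set f' := repr _; set g' := repr _.
have -> : f' ⊣ g' - f ⊣ g = (f' - f) ⊣ g' + f ⊣ (g' - g).
  by rewrite (lB _ _ (@dial_r_linearl _ _ _)) (rB _ _ (@dial_r_linearr _ _ _)) addrA subrK.
by apply: ID; [case: (Im _ g' (reprI f)) | case: (Im _ f (reprI g))].
Qed.

Lemma dquot_ind (P : dquot -> Prop) : (forall f, P (dproj f)) -> forall q, P q.
Proof. by move=> Pf q; rewrite -[q]dreprK. Qed.

Fact dquot_scaleA a b q :
  dquot_scale a (dquot_scale b q) = dquot_scale (a * b) q.
Proof. by elim/dquot_ind: q => f; rewrite !dproj_scale scalerA. Qed.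
Fact dquot_scale1 : left_id 1 dquot_scale.
Proof. by elim/dquot_ind=> f; rewrite dproj_scale scale1r. Qed.
Fact dquot_scaleDr : right_distributive dquot_scale +%R.
Proof.
move=> a; elim/dquot_ind=> f; elim/dquot_ind=> g.
by rewrite -dprojD !dproj_scale scalerDr dprojD.
Qed.
Fact dquot_scaleDl q : {morph dquot_scale^~ q : a b / a + b}.
Proof.
by move=> a b; elim/dquot_ind: q => f; rewrite !dproj_scale scalerDl dprojD.
Qed.

HB.instance Definition _ := GRing.Zmodule_isLmodule.Build k dquot
  dquot_scaleA dquot_scale1 dquot_scaleDr dquot_scaleDl.

Lemma dprojZ c f : dproj (c *: f) = c *: dproj f.
Proof. by rewrite -dproj_scale. Qed.

Fact dquot_l_linearl q : linear (dquot_l^~ q).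
Proof.
elim/dquot_ind: q => h a; elim/dquot_ind=> f; elim/dquot_ind=> g.
by rewrite -dprojZ -dprojD !dproj_l dial_l_linearl dprojD dprojZ.
Qed.
Fact dquot_l_linearr q : linear (dquot_l q).
Proof.
elim/dquot_ind: q => h a; elim/dquot_ind=> f; elim/dquot_ind=> g.
by rewrite -dprojZ -dprojD !dproj_l dial_l_linearr dprojD dprojZ.
Qed.
Fact dquot_r_linearl q : linear (dquot_r^~ q).
Proof.
elim/dquot_ind: q => h a; elim/dquot_ind=> f; elim/dquot_ind=> g.
by rewrite -dprojZ -dprojD !dproj_r dial_r_linearl dprojD dprojZ.
Qed.
Fact dquot_r_linearr q : linear (dquot_r q).
Proof.
elim/dquot_ind: q => h a; elim/dquot_ind=> f; elim/dquot_ind=> g.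
by rewrite -dprojZ -dprojD !dproj_r dial_r_linearr dprojD dprojZ.
Qed.
Fact dquot_lA : associative dquot_l.
Proof.
elim/dquot_ind=> f; elim/dquot_ind=> g; elim/dquot_ind=> h.
by rewrite !dproj_l dial_lA.
Qed.
Fact dquot_rA : associative dquot_r.
Proof.
elim/dquot_ind=> f; elim/dquot_ind=> g; elim/dquot_ind=> h.
by rewrite !dproj_r dial_rA.
Qed.
Fact dquot_rl a b c : dquot_r a (dquot_l b c) = dquot_r a (dquot_r b c).
Proof.
elim/dquot_ind: a => f; elim/dquot_ind: b => g; elim/dquot_ind: c => h.
by rewrite dproj_l !dproj_r dial_rl.
Qed.
Fact dquot_lr a b c : dquot_l (dquot_r a b) c = dquot_l (dquot_l a b) c.
Proof.
elim/dquot_ind: a => f; elim/dquot_ind: b => g; elim/dquot_ind: c => h.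
by rewrite dproj_r !dproj_l dial_lr.
Qed.
Fact dquot_inner a b c : dquot_l a (dquot_r b c) = dquot_r (dquot_l a b) c.
Proof.
elim/dquot_ind: a => f; elim/dquot_ind: b => g; elim/dquot_ind: c => h.
by rewrite !(dproj_r, dproj_l) dial_inner.
Qed.

HB.instance Definition _ := Lmodule_isDialgebra.Build k dquot
  dquot_l_linearl dquot_l_linearr dquot_r_linearl dquot_r_linearr
  dquot_lA dquot_rA dquot_rl dquot_lr dquot_inner.

End Quotient.

Section Basis.
Variables (k : fieldType) (V : lmodType k).

Definition is_basis (B : set V) : Prop :=
  (forall (r : seq V) (c : V -> k), uniq r -> (forall v, v \in r -> B v) ->
     \sum_(v <- r) c v *: v = 0 -> forall v, v \in r -> c v = 0) /\
  (forall v, exists (r : seq V) (c : V -> k),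
     (forall b, b \in r -> B b) /\ v = \sum_(b <- r) c b *: b).

End Basis.

Fact diword_display : Order.disp_t. Proof. exact: Order.Disp tt tt. Qed.

Section Diword.
Context {disp : Order.disp_t} (X : orderType disp).

(* The words on X, ordered by deg-lex: the order is pulled back along
   w |-> (|w|, w) from the lexicographic product of nat and seqlexi X. *)
Definition deglex : Type := seq X.

Definition deglex_key (w : deglex) : nat *l seqlexi X := (size w, w).

Definition deglex_le (u v : deglex) : bool := (deglex_key u <= deglex_key v)%O.

Fact deglex_refl : reflexive deglex_le. Proof. by move=> u; apply: lexx. Qed.
Fact deglex_anti : antisymmetric deglex_le.
Proof. by move=> u v /le_anti []. Qed.
Fact deglex_trans : transitive deglex_le.
Proof. by move=> u v w; apply: le_trans. Qed.

HB.instance Definition _ := Choice.on deglex.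
HB.instance Definition _ := Order.Le_isPOrder.Build diword_display deglex
  deglex_refl deglex_anti deglex_trans.
HB.instance Definition _ :=
  Order.MonoTotal.Build diword_display deglex (fun _ _ => erefl).

(* [u]_m, ordered lexicographically as the pair (u, m). *)
Record diword : Type := Diword {
  dipair :> deglex *l nat;
  _ : (0 < dipair.2 <= size (dipair.1 : seq X))%N }.

HB.instance Definition _ := [isSub for dipair].
HB.instance Definition _ := [Choice of diword by <:].
HB.instance Definition _ :=
  [SubChoice_isSubOrder of diword by <: with diword_display].

Definition word (d : diword) : seq X := (dipair d).1.
Definition center (d : diword) : nat := (dipair d).2.

Fact diword_l_subproof (d e : diword) :
  (0 < size (word d) + center e <= size (word d ++ word e))%N.
Proof.
by have /andP[n0 nv] := valP e; rewrite size_cat leq_add2l addn_gt0 n0 orbT.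
Qed.

Fact diword_r_subproof (d e : diword) :
  (0 < center d <= size (word d ++ word e))%N.
Proof. by have /andP[m0 mu] := valP d; rewrite size_cat m0 (leq_trans mu) ?leq_addr. Qed.

Definition diword_l (d e : diword) : diword :=
  @Diword (word d ++ word e, (size (word d) + center e)%N)
    (diword_l_subproof d e).
Definition diword_r (d e : diword) : diword :=
  @Diword (word d ++ word e, center d) (diword_r_subproof d e).

Lemma diwordP (d e : diword) : word d = word e -> center d = center e -> d = e.
Proof.
rewrite /word /center => wde cde; apply: val_inj.
rewrite /= [dipair d]surjective_pairing [dipair e]surjective_pairing.
by rewrite wde cde.
Qed.

Lemma word_l d e : word (diword_l d e) = word d ++ word e. Proof. by []. Qed.
Lemma word_r d e : word (diword_r d e) = word d ++ word e. Proof. by []. Qed.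
Lemma center_l d e : center (diword_l d e) = (size (word d) + center e)%N.
Proof. by []. Qed.
Lemma center_r d e : center (diword_r d e) = center d. Proof. by []. Qed.

Definition diwordE := (word_l, word_r, center_l, center_r).

Lemma diword_lA : associative diword_l.
Proof. by move=> d e c; apply: diwordP; rewrite !diwordE ?catA // size_cat addnA. Qed.
Lemma diword_rA : associative diword_r.
Proof. by move=> d e c; apply: diwordP; rewrite !diwordE ?catA. Qed.
Lemma diword_rl d e c : diword_r d (diword_l e c) = diword_r d (diword_r e c).
Proof. by apply: diwordP; rewrite !diwordE. Qed.
Lemma diword_lr d e c : diword_l (diword_r d e) c = diword_l (diword_l d e) c.
Proof. by apply: diwordP; rewrite !diwordE. Qed.
Lemma diword_inner d e c :
  diword_l d (diword_r e c) = diword_r (diword_l d e) c.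
Proof. by apply: diwordP; rewrite !diwordE ?catA. Qed.

End Diword.

Section LinearExtension.
Variables (k : fieldType) (K : choiceType) (V : lmodType k) (h : K -> V).

Definition lext (f : {malg k[K]}) : V := \sum_(d <- msupp f) f@_d *: h d.

Lemma lextEw (dom : {fset K}) f : (msupp f `<=` dom)%fset ->
  lext f = \sum_(d <- dom) f@_d *: h d.
Proof.
move=> sfd; apply: big_fset_incl => // d _ /mcoeff_outdom ->.
by rewrite scale0r.
Qed.

Lemma lext_linear : linear lext.
Proof.
move=> c f g; set dom := (msupp (c *: f + g) `|` (msupp f `|` msupp g))%fset.
rewrite (@lextEw dom) ?fsubsetUl // (@lextEw dom f); last first.
  by rewrite fsubsetU // fsubsetUl orbT.
rewrite (@lextEw dom g); last by rewrite fsubsetU // fsubsetUr orbT.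
rewrite scaler_sumr -big_split; apply: eq_bigr => d _ /=.
by rewrite mcoeffD mcoeffZ scalerDl scalerA.
Qed.

Lemma lextU d : lext << d >> = h d.
Proof.
by rewrite (@lextEw [fset d]%fset) ?msuppU_le // big_seq_fset1 mcoeffUU scale1r.
Qed.

End LinearExtension.

Lemma malg_lin_ind (k : fieldType) (K : choiceType) (P : {malg k[K]} -> Prop) :
  P 0 -> (forall c f g, P f -> P g -> P (c *: f + g)) -> (forall d, P << d >>) ->
  forall f, P f.
Proof.
move=> P0 Pl PU f; rewrite [f]monalgE; elim/big_rec: _ => // d g _ Pg.
suff -> : << f@_d *g d >> = f@_d *: << d >> :> {malg k[K]} by apply: Pl.
by apply/malgP => e; rewrite mcoeffZ !mcoeffU; case: eqP; rewrite ?mulr1 ?mulr0.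
Qed.

Section FreeDialgebraDefs.
Context {disp : Order.disp_t} (k : fieldType) (X : orderType disp).

Definition Di : Type := {malg k[diword X]}.
HB.instance Definition _ := GRing.Lmodule.on Di.
End FreeDialgebraDefs.

(* The basis element of Di<X> given by a normal diword. It is locked, like the
   products below, because conversion through mkmalgU is very slow. *)
HB.lock Definition dib {disp : Order.disp_t} {k : fieldType}
  {X : orderType disp} (d : diword X) : Di k X := << d >>.

HB.lock Definition di_l {disp : Order.disp_t} {k : fieldType}
    {X : orderType disp} (f g : Di k X) : Di k X :=
  lext (fun d => lext (fun e => dib (diword_l d e)) g) f.

HB.lock Definition di_r {disp : Order.disp_t} {k : fieldType}
    {X : orderType disp} (f g : Di k X) : Di k X :=
  lext (fun d => lext (fun e => dib (diword_r d e)) g) f.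

Section FreeDialgebra.
Context {disp : Order.disp_t} (k : fieldType) (X : orderType disp).
Local Notation Di := (Di k X).

Lemma di_lUU d e : di_l (dib d) (dib e) = dib (diword_l d e) :> Di.
Proof. by rewrite di_l.unlock dib.unlock !lextU. Qed.
Lemma di_rUU d e : di_r (dib d) (dib e) = dib (diword_r d e) :> Di.
Proof. by rewrite di_r.unlock dib.unlock !lextU. Qed.

Fact di_l_linearl g : linear (fun f : Di => di_l f g).
Proof. by rewrite di_l.unlock; exact: lext_linear. Qed.
Fact di_r_linearl g : linear (fun f : Di => di_r f g).
Proof. by rewrite di_r.unlock; exact: lext_linear. Qed.

Let lext_lin2 (m : diword X -> diword X -> Di) (f : Di) :
  linear (fun g : Di => lext (fun d => lext (m d) g) f).
Proof.
move=> c g h; rewrite /lext scaler_sumr -big_split; apply: eq_bigr => d _ /=.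
rewrite -/(lext (m d) (c *: g + h)) lext_linear scalerDr !scalerA.
by rewrite [c * _]mulrC.
Qed.

Fact di_l_linearr f : linear (@di_l disp k X f).
Proof. by rewrite di_l.unlock; exact: lext_lin2. Qed.
Fact di_r_linearr f : linear (@di_r disp k X f).
Proof. by rewrite di_r.unlock; exact: lext_lin2. Qed.

Let tri_ext (s t : Di -> Di -> Di -> Di) :
  (forall g h, linear (fun f => s f g h)) ->
  (forall f h, linear (fun g => s f g h)) -> (forall f g, linear (s f g)) ->
  (forall g h, linear (fun f => t f g h)) ->
  (forall f h, linear (fun g => t f g h)) -> (forall f g, linear (t f g)) ->
  (forall d e c, s (dib d) (dib e) (dib c) = t (dib d) (dib e) (dib c)) ->
  forall f g h, s f g h = t f g h.
Proof.
have ext (u v : Di -> Di) : linear u -> linear v ->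
    (forall d, u (dib d) = v (dib d)) -> forall f, u f = v f.
  move=> lu lv uv; rewrite dib.unlock in uv; apply: malg_lin_ind => // [|c f g uvf uvg].
    have lin0 w : linear w -> w 0 = 0 :> Di.
      by move=> /(_ (-1) 0 0); rewrite scaler0 addr0 scaleN1r addNr.
    by rewrite !lin0.
  by rewrite lu lv uvf uvg.
move=> s1 s2 s3 t1 t2 t3 st f g h; move: f; apply: (ext) => // d.
move: g; apply: (ext) => // e; move: h; exact: ext.
Qed.

Let lin_comp (u v : Di -> Di) : linear u -> linear v -> linear (fun f => u (v f)).
Proof. by move=> lu lv c f g; rewrite lv lu. Qed.

Let ll := di_l_linearl. Let lr := di_l_linearr.
Let rl := di_r_linearl. Let rr := di_r_linearr.

Fact di_lA : associative (@di_l disp k X).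
Proof.
apply: (tri_ext (s := fun f g h : Di => di_l f (di_l g h))
                (t := fun f g h : Di => di_l (di_l f g) h))
  => [g h|f h|f g|g h|f h|f g|d e c].
- exact: ll.
- exact: (lin_comp (lr f) (ll h)).
- exact: (lin_comp (lr f) (lr g)).
- exact: (lin_comp (ll h) (ll g)).
- exact: (lin_comp (ll h) (lr f)).
- exact: lr.
by rewrite !di_lUU diword_lA.
Qed.

Fact di_rA : associative (@di_r disp k X).
Proof.
apply: (tri_ext (s := fun f g h : Di => di_r f (di_r g h))
                (t := fun f g h : Di => di_r (di_r f g) h))
  => [g h|f h|f g|g h|f h|f g|d e c].
- exact: rl.
- exact: (lin_comp (rr f) (rl h)).
- exact: (lin_comp (rr f) (rr g)).
- exact: (lin_comp (rl h) (rl g)).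
- exact: (lin_comp (rl h) (rr f)).
- exact: rr.
by rewrite !di_rUU diword_rA.
Qed.

Fact di_rl (f g h : Di) : di_r f (di_l g h) = di_r f (di_r g h).
Proof.
move: f g h; apply: (tri_ext (s := fun f g h : Di => di_r f (di_l g h))
                             (t := fun f g h : Di => di_r f (di_r g h)))
  => [g h|f h|f g|g h|f h|f g|d e c].
- exact: rl.
- exact: (lin_comp (rr f) (ll h)).
- exact: (lin_comp (rr f) (lr g)).
- exact: rl.
- exact: (lin_comp (rr f) (rl h)).
- exact: (lin_comp (rr f) (rr g)).
by rewrite di_lUU !di_rUU diword_rl.
Qed.

Fact di_lr (f g h : Di) : di_l (di_r f g) h = di_l (di_l f g) h.
Proof.
move: f g h; apply: (tri_ext (s := fun f g h : Di => di_l (di_r f g) h)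
                             (t := fun f g h : Di => di_l (di_l f g) h))
  => [g h|f h|f g|g h|f h|f g|d e c].
- exact: (lin_comp (ll h) (rl g)).
- exact: (lin_comp (ll h) (rr f)).
- exact: lr.
- exact: (lin_comp (ll h) (ll g)).
- exact: (lin_comp (ll h) (lr f)).
- exact: lr.
by rewrite di_rUU !di_lUU diword_lr.
Qed.

Fact di_inner (f g h : Di) : di_l f (di_r g h) = di_r (di_l f g) h.
Proof.
move: f g h; apply: (tri_ext (s := fun f g h : Di => di_l f (di_r g h))
                             (t := fun f g h : Di => di_r (di_l f g) h))
  => [g h|f h|f g|g h|f h|f g|d e c].
- exact: ll.
- exact: (lin_comp (lr f) (rl h)).
- exact: (lin_comp (lr f) (rr g)).
- exact: (lin_comp (rl h) (ll g)).
- exact: (lin_comp (rl h) (lr f)).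
- exact: rr.
by rewrite di_rUU !di_lUU di_rUU diword_inner.
Qed.

HB.instance Definition _ := Lmodule_isDialgebra.Build k Di
  di_l_linearl di_l_linearr di_r_linearl di_r_linearr
  di_lA di_rA di_rl di_lr di_inner.

Lemma dib_l (d e : diword X) : (dib d : Di) ⊢ dib e = dib (diword_l d e).
Proof. exact: di_lUU. Qed.
Lemma dib_r (d e : diword X) : (dib d : Di) ⊣ dib e = dib (diword_r d e).
Proof. exact: di_rUU. Qed.

End FreeDialgebra.

Section Leading.
Context {disp : Order.disp_t} {k : fieldType} {X : orderType disp}.
Implicit Types f g s : Di k X.

(* \overline f, with None standing for \overline 0 = 0. *)
Definition lead f : option (diword X) :=
  ohead (sort (fun d e : diword X => (e <= d)%O) (msupp f)).

Definition lead_le (o o' : option (diword X)) : bool :=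
  match o, o' with
  | None, _ => true
  | Some _, None => false
  | Some d, Some e => (d <= e)%O
  end.

Definition lc f : k := if lead f is Some d then f@_d else 0.
Definition lterm f : Di k X := if lead f is Some d then f@_d *: dib d else 0.
Definition rest f : Di k X := f - lterm f.

(* \widetilde f; the empty word stands for \widetilde 0 = 0, as it lies below
   every word of X^+ in deg-lex. *)
Definition lead_word f : deglex X := if lead f is Some d then word d else [::].

(* p(\overline f), only meaningful for f != 0. *)
Definition lead_center f : nat := if lead f is Some d then center d else 0%N.

Definition monic f : Prop := f != 0 /\ lc f = 1.

Definition strong f : bool :=
  (f != 0) && (lead_word (rest f) < lead_word f)%O.

(* [u]_m for arbitrary u and m; it is 0 when [u]_m is not a normal diword,
   i.e. unless 1 <= m <= |u|. *)
Definition dw (u : seq X) (m : nat) : Di k X :=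
  if insub ((u, m) : deglex X *l nat) is Some d then dib d else 0.

Definition mul_left (op : Di k X -> Di k X -> Di k X) (a : seq X) (m : nat) f :=
  if a is [::] then f else op (dw a m) f.
Definition mul_right (op : Di k X -> Di k X -> Di k X) f (b : seq X) (m : nat) :=
  if b is [::] then f else op f (dw b m).

(* m \in P([asb]) *)
Definition inP (a : seq X) s (b : seq X) (m : nat) : bool :=
  let c := (size a + size (lead_word s : seq X))%N in
  (m == size a + lead_center s)%N
  || strong s && ((1 <= m <= size a) || (c < m <= c + size b))%N.

(* The normal S-diword [asb]_m, for m \in P([asb]). *)
Definition nsd (a : seq X) s (b : seq X) (m : nat) : Di k X :=
  let c := (size a + size (lead_word s : seq X))%N in
  if (m <= size a)%N then
    mul_right dial_r (mul_left dial_r a m s) b 1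
  else if (m <= c)%N then
    mul_right dial_r (mul_left dial_l a (size a) s) b 1
  else
    mul_right dial_l (mul_left dial_l a (size a) s) b (m - c).

Variable S : set (Di k X).

Inductive composition : Di k X -> Prop :=
| Comp_left f x of S f & ~~ strong f :
    composition (dw [:: x] 1 ⊣ f)
| Comp_right f u of S f & ~~ strong f & u != [::] :
    composition (f ⊢ dw u (size u))
| Comp_incl f g a b of S f & S g
    & lead_word f = a ++ lead_word g ++ b
    & inP a g b (lead_center f) :
    composition (f - nsd a g b (lead_center f))
| Comp_incl_l f g a b x of S f & S g
    & lead_word f = a ++ lead_word g ++ b
    & ~~ inP a g b (lead_center f) & strong f & strong g :
    composition (nsd [:: x] f [::] 1 - nsd (x :: a) g b 1)
| Comp_incl_r f g a b x of S f & S g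
    & lead_word f = a ++ lead_word g ++ b
    & ~~ inP a g b (lead_center f) & strong f & strong g :
    composition (nsd [::] f [:: x] (size (lead_word f : seq X)).+1
                 - nsd a g (rcons b x) (size (lead_word f : seq X)).+1)
| Comp_inter f g a b m of S f & S g
    & lead_word f ++ b = a ++ lead_word g
    & (size (lead_word f ++ b)
       < size (lead_word f : seq X) + size (lead_word g : seq X))%N
    & inP [::] f b m & inP a g [::] m :
    composition (nsd [::] f b m - nsd a g [::] m)
| Comp_inter_l f g a b x of S f & S g
    & lead_word f ++ b = a ++ lead_word g
    & (size (lead_word f ++ b)
       < size (lead_word f : seq X) + size (lead_word g : seq X))%N
    & (forall m, ~~ (inP [::] f b m && inP a g [::] m))
    & strong f & strong g :
    composition (nsd [:: x] f b 1 - nsd (x :: a) g [::] 1)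
| Comp_inter_r f g a b x of S f & S g
    & lead_word f ++ b = a ++ lead_word g
    & (size (lead_word f ++ b)
       < size (lead_word f : seq X) + size (lead_word g : seq X))%N
    & (forall m, ~~ (inP [::] f b m && inP a g [::] m))
    & strong f & strong g :
    composition (nsd [::] f (rcons b x) (size (lead_word f ++ b)).+1
                 - nsd a g [:: x] (size (lead_word f ++ b)).+1).

Definition trivial_mod (h : Di k X) : Prop :=
  exists (n : nat) (c : 'I_n -> k) (a b : 'I_n -> seq X)
         (s : 'I_n -> Di k X) (m : 'I_n -> nat),
    (forall i, [/\ S (s i), inP (a i) (s i) (b i) (m i) &
       lead_le (lead (nsd (a i) (s i) (b i) (m i))) (lead h)]) /\
    h = \sum_(i < n) c i *: nsd (a i) (s i) (b i) (m i).

Definition Groebner_Shirshov : Prop :=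
  (forall s, S s -> monic s) /\ (forall h, composition h -> trivial_mod h).

(* A set of normal diwords is a basis of Di<X | S> when its elements have
   distinct images and these images form a basis. *)
Definition quotient_basis (B : set (diword X)) : Prop :=
  (forall d e, B d -> B e -> dproj S (dib d) = dproj S (dib e) -> d = e) /\
  is_basis [set dproj S (dib d) | d in B].

End Leading.

Section FreeCommutative.
Context {disp : Order.disp_t} (k : fieldType) (X : orderType disp).

Definition comm_rel : set (Di k X) :=
  [set f | exists d e : diword X,
     f = dib d ⊢ dib e - dib e ⊢ dib d \/ f = dib d ⊣ dib e - dib e ⊣ dib d].

(* \lfloor u \rfloor *)
Definition sortw (u : seq X) : seq X := sort (fun x y : X => (x <= y)%O) u.

Definition sort_rel : set (Di k X) :=
  [set f | f != 0 /\ exists d : diword X,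
     (size (word d) = 2%N /\ f = dib d - dw (sortw (word d)) (center d)) \/
     ((3 <= size (word d))%N /\ f = dib d - dw (sortw (word d)) 1)].

Definition sorted_words : set (seq X) := [set sortw u | u in [set u | u != [::]]].

Definition sorted_1 : set (diword X) :=
  [set d | sorted_words (word d) /\ center d = 1%N].

Definition sorted_22 : set (diword X) :=
  [set d | [/\ sorted_words (word d), size (word d) = 2%N & center d = 2%N]].

End FreeCommutative.

Arguments comm_rel {disp} k X _.
Arguments sort_rel {disp} k X _.
Arguments sorted_1 {disp} X _.
Arguments sorted_22 {disp} X _.

(* Main.v *)
(* Let nf send [u]_m to the diword with sorted word and with center m if
   |u| <= 2, and 1 otherwise; extend it linearly to NF. Then NF (f * g) depends
   only on NF f and NF g, so ker NF is an ideal. As every f with NF f = 0 is the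
   sum of the f_d (d - nf d), and the nonzero d - nf d are exactly the elements
   of S, ker NF = Id(S), and this expansion already exhibits every element of
   Id(S), in particular every composition, as trivial modulo S. The ideal ker NF
   contains T since nf (d * e) = nf (e * d), and conversely S lies in Id(T)
   because, modulo T, rotations bring the center to the first place and
   transpositions then sort the word. The basis consists of the fixed points
   of nf. *)
Require Import Defs.
From HB Require Import structures.
From mathcomp Require Import all_boot all_order all_algebra.
From mathcomp Require Import finmap monalg.
From mathcomp Require Import zify.
From mathcomp Require Import boolp classical_sets.

Set Implicit Arguments.
Unset Strict Implicit.
Unset Printing Implicit Defensive.

Import Order.TTheory GRing.Theory.

Local Open Scope ring_scope.
Local Open Scope classical_set_scope.

(** * Sorted words and normal forms of diwords *)

Section Words.
Context {disp : Order.disp_t} (X : orderType disp).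
Implicit Types (u v w : seq X) (d e : diword X).

Lemma size_sortw u : size (sortw u) = size u.
Proof. exact: size_sort. Qed.

Lemma perm_sortw u : perm_eq (sortw u) u.
Proof. by rewrite perm_sort. Qed.

Lemma sortw_perm u v : perm_eq u v -> sortw u = sortw v.
Proof. exact/perm_sortP/le_anti/le_trans/le_total. Qed.

Lemma sortw_id u : sortw (sortw u) = sortw u.
Proof. exact/sortw_perm/perm_sortw. Qed.

(** The head of a sorted word is minimal among the letters of [v]; equal heads cancel and the
    induction continues. *)
Lemma sorted_lexi_le u v :
  sorted (fun x y : X => (x <= y)%O) u -> perm_eq u v ->
  ((u : seqlexi X) <= v)%O.
Proof.
elim: u v => [|x u IH] v; first by move=> _ /perm_size; case: v.
case: v => [|y v] /= su; first by move=> /perm_size.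
move=> puv; have xy : (x <= y)%O.
  have : y \in x :: u by rewrite (perm_mem puv) mem_head.
  rewrite inE => /predU1P[->//|yu].
  by have /allP/(_ _ yu) := order_path_min le_trans su.
rewrite lexi_cons xy /=; apply/implyP => yx; apply: IH (path_sorted su) _.
have /eqP exy : x == y by rewrite eq_le xy yx.
by rewrite exy perm_cons in puv.
Qed.

Lemma sortw_le u : ((sortw u : deglex X) <= u)%O.
Proof.
rewrite /Order.le /= /deglex_le /deglex_key lexi_pair size_sortw lexx /=.
by apply: sorted_lexi_le (perm_sortw u); apply: sort_sorted => x y; apply: le_total.
Qed.

Lemma sortw_cat u v : sortw (sortw u ++ sortw v) = sortw (u ++ v).
Proof. by apply: sortw_perm; rewrite perm_cat ?perm_sortw. Qed.

Lemma sortw_catC u v : sortw (u ++ v) = sortw (v ++ u).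
Proof. by apply: sortw_perm; rewrite perm_catC. Qed.

Definition nf_center d : nat := if (size (word d) <= 2)%N then center d else 1%N.

Fact nf_subproof d : (0 < nf_center d <= size (sortw (word d)))%N.
Proof.
have /andP[c0 cd] := valP d; rewrite size_sortw /nf_center.
by case: ifP => _; rewrite ?c0 //; apply: leq_trans c0 cd.
Qed.

Definition nf d : diword X :=
  @Diword _ X (sortw (word d), nf_center d) (nf_subproof d).

Lemma word_nf d : word (nf d) = sortw (word d). Proof. by []. Qed.
Lemma center_nf d : center (nf d) = nf_center d. Proof. by []. Qed.

Lemma center_gt0 d : (0 < center d)%N.
Proof. by have /andP[] := valP d. Qed.
Lemma center_le d : (center d <= size (word d))%N.
Proof. by have /andP[] := valP d. Qed.

Lemma nf_center_le d : (nf_center d <= center d)%N.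
Proof. by rewrite /nf_center; case: ifP => // _; apply: center_gt0. Qed.

(** This makes [d] the leading diword of [d - nf d] whenever the difference is nonzero. *)
Lemma nf_le d : (nf d <= d)%O.
Proof.
rewrite -Order.le_val /= [val d]surjective_pairing lexi_pair sortw_le /=.
by apply/implyP => _; apply: nf_center_le.
Qed.

Lemma size_word_gt0 d : (0 < size (word d))%N.
Proof. exact: leq_trans (center_gt0 d) (center_le d). Qed.

(** In a product of length 2 both factors are single letters, whose center [nf] keeps at 1; in
    longer products the center is reset to 1 on both sides. *)
Lemma nf_l d e : nf (diword_l (nf d) (nf e)) = nf (diword_l d e).
Proof.
apply: diwordP; first by rewrite !word_nf !diwordE sortw_cat.
rewrite !center_nf /nf_center !diwordE !word_nf !size_cat !size_sortw !center_nf.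
rewrite /nf_center; case: ifP => // s2; have := size_word_gt0 d.
by have := size_word_gt0 e; do 2?case: ifP; lia.
Qed.
Lemma nf_r d e : nf (diword_r (nf d) (nf e)) = nf (diword_r d e).
Proof.
apply: diwordP; first by rewrite !word_nf !diwordE sortw_cat.
rewrite !center_nf /nf_center !diwordE !word_nf !size_cat !size_sortw !center_nf.
rewrite /nf_center; case: ifP => // s2; have := size_word_gt0 d.
by have := size_word_gt0 e; do 2?case: ifP; lia.
Qed.

Lemma nf_id d : nf (nf d) = nf d.
Proof.
apply: diwordP; first by rewrite !word_nf sortw_id.
by rewrite !center_nf /nf_center word_nf size_sortw center_nf /nf_center; case: leqP.
Qed.

(** For two letters both products have center 2; in longer products [nf] forgets the center. *)
Lemma nf_l_comm d e : nf (diword_l d e) = nf (diword_l e d).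
Proof.
apply: diwordP; first by rewrite !word_nf !diwordE sortw_catC.
rewrite !center_nf /nf_center !diwordE !size_cat addnC; case: ifP => // s2.
by move: s2 (center_gt0 d) (center_gt0 e) (center_le d) (center_le e); lia.
Qed.
Lemma nf_r_comm d e : nf (diword_r d e) = nf (diword_r e d).
Proof.
apply: diwordP; first by rewrite !word_nf !diwordE sortw_catC.
rewrite !center_nf /nf_center !diwordE !size_cat addnC; case: ifP => // s2.
by move: s2 (center_gt0 d) (center_gt0 e) (center_le d) (center_le e); lia.
Qed.

Lemma nf_fixed d : (sorted_1 X `|` sorted_22 X) d <-> nf d = d.
Proof.
split=> [H|dE].
  have sd : sortw (word d) = word d.
    by case: H => [[[u _ <-] _]|[[u _ <-] _ _]]; rewrite sortw_id.
  apply: diwordP; rewrite ?word_nf // center_nf /nf_center.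
  by case: H => [[_ ->]|[_ -> ->]] //; case: ifP.
have sw : sorted_words (word d).
  exists (word d); last by rewrite -word_nf dE.
  by rewrite /= -size_eq0 -lt0n size_word_gt0.
have := congr1 (@center _ X) dE; rewrite center_nf /nf_center.
have := center_le d; have := center_gt0 d.
(* A center other than 1 survives [nf] only in length at most 2, and then center and length are both
   2. *)
case: (eqVneq (center d) 1%N) => [d1 *|d1]; first by left.
case: (leqP _ 2) => [s2 c0 cs _|_ _ _ c1]; last by rewrite c1 eqxx in d1.
by right; split=> //; lia.
Qed.

End Words.

(* Locked for the same reason as dib. *)
HB.lock Definition NF {disp : Order.disp_t} {k : fieldType} {X : orderType disp} :
  Di k X -> Di k X := lext (fun d => dib (nf d)).

(** * The linear map [NF] and its kernel *)

Section NormalForm.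
Context {disp : Order.disp_t} (k : fieldType) (X : orderType disp).
Local Notation Di := (Di k X).
Implicit Types (f g h : Di) (d e : diword X) (u v w : seq X) (m n : nat).

Lemma Di_ind (P : Di -> Prop) :
  P 0 -> (forall c f g, P f -> P g -> P (c *: f + g)) -> (forall d, P (dib d)) ->
  forall f, P f.
Proof. by rewrite dib.unlock; apply: malg_lin_ind. Qed.

Lemma dib_coef d e : mcoeff e (dib d : Di) = (d == e)%:R.
Proof. by rewrite dib.unlock mcoeffU. Qed.

Lemma dib_inj : injective (dib : diword X -> Di).
Proof.
move=> d e /(congr1 (mcoeff e)); rewrite !dib_coef eqxx; case: eqVneq => // _.
by move/esym/eqP; rewrite oner_eq0.
Qed.

Lemma lext_dib (V : lmodType k) (h : diword X -> V) d : lext h (dib d : Di) = h d.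
Proof. by rewrite dib.unlock lextU. Qed.

Fact NF_linear : linear (@NF disp k X).
Proof. by rewrite NF.unlock; apply: lext_linear. Qed.
HB.instance Definition _ := GRing.isLinear.Build k Di Di *:%R NF NF_linear.

Lemma NF_dib d : NF (dib d) = dib (nf d) :> Di.
Proof. by rewrite NF.unlock lext_dib. Qed.

Lemma Di_sum f : f = \sum_(d <- msupp f) mcoeff d f *: (dib d : Di).
Proof.
rewrite -[RHS]/(lext (fun d => dib d : Di) f); elim/Di_ind: f => [|c f g Pf Pg|d].
- by rewrite /lext msupp0 big_seq_fset0.
- by rewrite lext_linear -Pf -Pg.
- by rewrite lext_dib.
Qed.

Lemma NF_sum f : NF f = \sum_(d <- msupp f) mcoeff d f *: (dib (nf d) : Di).
Proof. by rewrite NF.unlock. Qed.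

Let linear_map0 (V W : lmodType k) (p : V -> W) : linear p -> p 0 = 0.
Proof. by move=> /(_ (-1) 0 0); rewrite scaler0 addr0 scaleN1r addNr. Qed.

Let dial0 f : [/\ 0 ⊢ f = 0, f ⊢ 0 = 0, 0 ⊣ f = 0 & f ⊣ 0 = 0].
Proof.
split.
- exact: (linear_map0 (dial_l_linearl f)).
- exact: (linear_map0 (dial_l_linearr f)).
- exact: (linear_map0 (dial_r_linearl f)).
- exact: (linear_map0 (dial_r_linearr f)).
Qed.

Lemma NF_id f : NF (NF f) = NF f.
Proof.
elim/Di_ind: f => [|c f g Pf Pg|d]; first by rewrite !linear0.
  by rewrite !linearP /= Pf Pg.
by rewrite !NF_dib nf_id.
Qed.

(** Both sides are bilinear, so it suffices to treat basis diwords, where [nf_l] applies. *)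
Lemma NF_l f g : NF (f ⊢ g) = NF (NF f ⊢ NF g).
Proof.
elim/Di_ind: f g => [|c f1 f2 IH1 IH2|d] g.
- by rewrite linear0; have [-> _ _ _] := dial0 g; have [-> _ _ _] := dial0 (NF g).
- by rewrite linearP !dial_l_linearl !linearP /= IH1 IH2.
elim/Di_ind: g => [|c g1 g2 IH1 IH2|e].
- rewrite linear0; have [_ -> _ _] := dial0 (dib d).
  by have [_ -> _ _] := dial0 (NF (dib d)).
- by rewrite linearP !dial_l_linearr !linearP /= IH1 IH2.
by rewrite !NF_dib !dib_l !NF_dib nf_l.
Qed.

Lemma NF_r f g : NF (f ⊣ g) = NF (NF f ⊣ NF g).
Proof.
elim/Di_ind: f g => [|c f1 f2 IH1 IH2|d] g.
- by rewrite linear0; have [_ _ -> _] := dial0 g; have [_ _ -> _] := dial0 (NF g).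
- by rewrite linearP !dial_r_linearl !linearP /= IH1 IH2.
elim/Di_ind: g => [|c g1 g2 IH1 IH2|e].
- rewrite linear0; have [_ _ _ ->] := dial0 (dib d).
  by have [_ _ _ ->] := dial0 (NF (dib d)).
- by rewrite linearP !dial_r_linearr !linearP /= IH1 IH2.
by rewrite !NF_dib !dib_r !NF_dib nf_r.
Qed.

Lemma ker_NF_ideal : is_ideal [set f : Di | NF f = 0].
Proof.
split=> [|c f g /= f0 g0|f g /= f0]; first exact: linear0.
  by rewrite linearP /= f0 g0 scaler0 addr0.
have [zl lz zr rz] := dial0 (NF g).
split; rewrite /=.
- by rewrite NF_l f0 zl linear0.
- by rewrite NF_l f0 lz linear0.
- by rewrite NF_r f0 zr linear0.
- by rewrite NF_r f0 rz linear0.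
Qed.

Lemma dw_dib d : dw (word d) (center d) = dib d :> Di.
Proof.
by rewrite /dw (_ : (_, _) = val d) ?valK // [RHS]surjective_pairing.
Qed.

(** The two families of generators merge into one, since [nf_center] is the old center in length 2
    and 1 from length 3 on. *)
Lemma sort_rel_nf f :
  sort_rel k X f <-> f != 0 /\ exists d, f = dib d - dib (nf d).
Proof.
have nfE d : dib (nf d) = dw (sortw (word d)) (nf_center d) :> Di.
  by rewrite -word_nf -center_nf dw_dib.
split=> [] [f0 [d dE]]; split=> //; exists d.
  by case: dE => [[ds ->]|[ds ->]]; rewrite nfE /nf_center leqNgt ds.
case: (ltngtP (size (word d)) 2) => ds; last first.
- by left; split; rewrite // dE nfE /nf_center ds.
- by right; split; rewrite // dE nfE /nf_center leqNgt ds.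
(* A diword of length 1 is its own normal form, so its difference is excluded by [f != 0]. *)
case/eqP: f0; rewrite dE; suff -> : nf d = d by rewrite subrr.
apply: diwordP; last by rewrite center_nf /nf_center (ltnW ds).
by rewrite word_nf; move: ds; case: (word d) => [|x []].
Qed.

Lemma sort_rel_basis d : nf d != d -> sort_rel k X (dib d - dib (nf d)).
Proof.
move=> nd; apply/sort_rel_nf; split; last by exists d.
by rewrite subr_eq0; apply: contra nd => /eqP/dib_inj <-.
Qed.

Lemma Id_sort_rel f : Id (sort_rel k X) f <-> NF f = 0.
Proof.
split=> [|f0].
  move=> /(_ _ ker_NF_ideal); apply=> s /sort_rel_nf [_ [d ->]] /=.
  by rewrite linearB /= !NF_dib nf_id subrr.
have [I0 Il _] := Id_ideal (sort_rel k X).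
(* Replacing [f] by [f - NF f] gives a sum of multiples of [d - nf d], each zero or a multiple of a
   generator. *)
rewrite -[f]subr0 -f0 [X in X - _]Di_sum NF_sum -sumrB.
elim/big_ind: _ => // [g h Ig Ih|d _]; first by rewrite -[g]scale1r; apply: Il.
rewrite -scalerBr -[_ *: _]addr0; apply: Il => //.
have [->|/sort_rel_basis nd] := eqVneq (nf d) d; first by rewrite subrr.
by move=> I _ SI; apply: SI.
Qed.

End NormalForm.

(** * Leading diwords and triviality of compositions *)

Section Compositions.
Context {disp : Order.disp_t} (k : fieldType) (X : orderType disp).
Local Notation Di := (Di k X).
Implicit Types (f g h : Di) (d e : diword X) (S : set Di).

(** The support is sorted in decreasing order, so its head is the maximum; [d] only witnesses that
    the support is nonempty. *)
Lemma lead_some f d : d \in msupp f ->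
  exists d0, [/\ lead f = Some d0, d0 \in msupp f &
                 forall e, e \in msupp f -> (e <= d0)%O].
Proof.
move=> df; set ge := fun d e : diword X => (e <= d)%O.
have : sorted ge (sort ge (msupp f)).
  by apply: sort_sorted => x y; apply: le_total.
have : d \in sort ge (msupp f) by rewrite mem_sort.
rewrite /lead -/ge; case defs: (sort _ _) => [//|d0 s] _ /= sd0.
have memE e : (e \in msupp f) = (e \in d0 :: s) by rewrite -defs mem_sort.
exists d0; split=> //; first by rewrite memE mem_head.
move=> e; rewrite memE inE => /predU1P[->//|es].
have /order_path_min /(_ sd0) /allP/(_ e es) // : transitive ge.
by move=> x y z yx zx; apply: le_trans zx yx.
Qed.

Lemma lead_eq f d : d \in msupp f -> (forall e, e \in msupp f -> (e <= d)%O) ->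
  lead f = Some d.
Proof.
move=> df fd; have [d0 [-> d0f fd0]] := lead_some df.
by congr Some; apply: le_anti; rewrite fd ?fd0.
Qed.

Lemma lead_sort_rel d : nf d != d -> lead (dib d - dib (nf d) : Di) = Some d.
Proof.
move=> nd; apply: lead_eq => [|e].
  rewrite -mcoeff_neq0 mcoeffB !dib_coef eqxx (negPf nd) subr0.
  exact: oner_neq0.
rewrite -mcoeff_neq0 mcoeffB !dib_coef; case: (eqVneq d e) => [->//|_].
by case: (eqVneq (nf d) e) => [<- _|_]; rewrite ?nf_le // subrr eqxx.
Qed.

Lemma sort_rel_monic s : sort_rel k X s -> Defs.monic s.
Proof.
case/sort_rel_nf=> s0 [d sE]; split=> //.
have nd : nf d != d.
  by apply: contra s0 => /eqP nd; rewrite sE nd subrr.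
by rewrite /lc sE lead_sort_rel // mcoeffB !dib_coef eqxx (negPf nd) subr0.
Qed.

Section InIdeal.
Variable S : set Di.
Let IdM f g : Id S f ->
  [/\ Id S (f ⊢ g), Id S (g ⊢ f), Id S (f ⊣ g) & Id S (g ⊣ f)].
Proof. by have [_ _] := Id_ideal S; apply. Qed.

Let Id_gen s : S s -> Id S s.
Proof. by move=> Ss I _; apply. Qed.

Let IdB f g : Id S f -> Id S g -> Id S (f - g).
Proof. by move=> /Id_predP If /Id_predP Ig; apply/Id_predP/rpredB. Qed.

(** Every branch of [nsd] multiplies [s] by at most one element on each side, so no condition on [m]
    enters. *)
Lemma Id_nsd (a : seq X) s (b : seq X) m : S s -> Id S (nsd a s b m).
Proof.
move=> /Id_gen Is.
have mulr op f : (forall g, Id S (op f g)) -> Id S f ->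
    forall n, Id S (mul_right op f b n).
  by move=> opI If n; rewrite /mul_right; case: b.
have mull op : (forall g, Id S (op g s)) -> forall n, Id S (mul_left op a n s).
  by move=> opI n; rewrite /mul_left; case: a.
have ml n : Id S (mul_left dial_l a n s).
  by apply: mull => g; case: (IdM g Is).
have mr n : Id S (mul_left dial_r a n s).
  by apply: mull => g; case: (IdM g Is).
by rewrite /nsd; case: ifP => _; last case: ifP => _; apply: mulr => // g;
  [case: (IdM g (mr m)) | case: (IdM g (ml (size a))) | case: (IdM g (ml (size a)))].
Qed.

(** Each composition is a product with a generator or a difference of two elements of the ideal,
    whatever the overlap of leading words. *)
Lemma Id_composition h : composition S h -> Id S h.
Proof.
case=> [f x Sf _|f u Sf _ _|*|*|*|*|*|*].
- by have [] := IdM (dw [:: x] 1) (Id_gen Sf).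
- by have [] := IdM (dw u (size u)) (Id_gen Sf).
all: by apply: IdB; (exact: Id_gen || exact: Id_nsd).
Qed.

End InIdeal.

(* The normal S-diwords used all have empty a and b. *)
Lemma NF0_trivial h : NF h = 0 -> trivial_mod (sort_rel k X) h.
Proof.
move=> h0.
(* Fixed points of [nf] are dropped: for them [d - nf d] is zero and hence not in S. *)
pose r := [seq d <- msupp h | nf d != d].
pose d_ (i : 'I_(size r)) := tnth (in_tuple r) i.
pose s_ (i : 'I_(size r)) : Di := dib (d_ i) - dib (nf (d_ i)).
have dP i : nf (d_ i) != d_ i /\ d_ i \in msupp h.
  by have := mem_tnth i (in_tuple r); rewrite mem_filter => /andP[].
have nsd_s i : nsd [::] (s_ i) [::] (lead_center (s_ i)) = s_ i.
  have -> m : nsd [::] (s_ i) [::] m = s_ i by rewrite /nsd; do 2?case: ifP.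
  by [].
exists (size r), (fun i => mcoeff (d_ i) h), (fun=> [::]), (fun=> [::]), s_,
  (fun i => lead_center (s_ i)); split=> [i|].
  have [nd dh] := dP i; split; first exact: sort_rel_basis.
    by rewrite /inP eqxx.
  (* The leading diword of the [i]-th summand is [d_ i], which lies in the support of [h]. *)
  have [d0 [-> _ hd0]] := lead_some dh.
  by rewrite nsd_s lead_sort_rel //= hd0.
under eq_bigr => i _ do rewrite nsd_s.
rewrite -(big_tnth _ _ r xpredT (fun d => mcoeff d h *: (dib d - dib (nf d) : Di))).
rewrite big_filter [in LHS](_ : h = h - NF h); last by rewrite h0 subr0.
rewrite [X in X - _]Di_sum NF_sum -sumrB [RHS]big_mkcond /=.
apply: eq_bigr => d _; rewrite -scalerBr; case: eqVneq => // ->.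
by rewrite subrr scaler0.
Qed.

Lemma sort_rel_GS : Groebner_Shirshov (sort_rel k X).
Proof.
split; first exact: sort_rel_monic.
by move=> h /Id_composition/Id_sort_rel/NF0_trivial.
Qed.

End Compositions.

(** * Rearranging words modulo commutativity *)

Section CommutativeIdeal.
Context {disp : Order.disp_t} (k : fieldType) (X : orderType disp).
Local Notation Di := (Di k X).
Implicit Types (f g h : Di) (d e : diword X) (u v w : seq X) (m n : nat).

Local Notation T := (comm_rel k X).

Lemma dw_valid u m : (0 < m <= size u)%N ->
  exists2 d : diword X, word d = u /\ center d = m & dw u m = dib d :> Di.
Proof.
move=> um; pose d : diword X := @Diword _ X (u, m) um.
by exists d => //; rewrite -dw_dib.
Qed.

Lemma dw_l u v m n : (0 < m <= size u)%N -> (0 < n <= size v)%N ->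
  dw u m ⊢ dw v n = dw (u ++ v) (size u + n) :> Di.
Proof.
move=> /dw_valid[d [<- _] ->] /dw_valid[e [<- <-] ->].
by rewrite dib_l -dw_dib.
Qed.

Lemma dw_r u v m n : (0 < m <= size u)%N -> (0 < n <= size v)%N ->
  dw u m ⊣ dw v n = dw (u ++ v) m :> Di.
Proof.
move=> /dw_valid[d [<- <-] ->] /dw_valid[e [<- _] ->].
by rewrite dib_r -dw_dib.
Qed.

(** Bare words and positions are used instead of diwords, so that words can be rewritten without
    carrying the bound on the center. *)
Definition comm_image u m : dquot T := dproj T (dw u m).
Local Notation q := comm_image.

Let dprojMr f g : dproj T (f ⊣ g) = dquot_r (dproj T f) (dproj T g).
Proof. by rewrite dproj_r. Qed.

(** The product [⊢] forgets the center of its left factor, so [m] and [n] are independent; likewise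
    for [⊣] below. *)
Lemma comm_image_l u v m n : (0 < m <= size u)%N -> (0 < n <= size v)%N ->
  q (u ++ v) (size u + n) = q (v ++ u) (size v + m).
Proof.
move=> um vn; apply/dprojP; rewrite -(dw_l um vn) -(dw_l vn um).
have [d _ ->] := dw_valid um; have [e _ ->] := dw_valid vn.
by move=> I _; apply; exists d, e; left.
Qed.

Lemma comm_image_r u v m n : (0 < m <= size u)%N -> (0 < n <= size v)%N ->
  q (u ++ v) m = q (v ++ u) n.
Proof.
move=> um vn; apply/dprojP; rewrite -(dw_r um vn) -(dw_r vn um).
have [d _ ->] := dw_valid um; have [e _ ->] := dw_valid vn.
by move=> I _; apply; exists d, e; right.
Qed.

Lemma comm_image_catr u u' v m m' :
  (0 < m <= size u)%N -> (0 < m' <= size u')%N ->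
  q u m = q u' m' -> q (u ++ v) m = q (u' ++ v) m'.
Proof.
case: v => [|x v] um um' quu'; first by rewrite !cats0.
rewrite /q -(@dw_r _ (x :: v) m 1) // -(@dw_r _ (x :: v) m' 1) //.
by rewrite !dprojMr -/(q u m) quu'.
Qed.

Lemma comm_image_cons x u u' : (0 < size u)%N -> (0 < size u')%N ->
  q u 1 = q u' 1 -> q (x :: u) 1 = q (x :: u') 1.
Proof.
move=> u0 u0' quu'; rewrite /q -(@dw_r [:: x] u 1 1) // -(@dw_r [:: x] u' 1 1) //.
by rewrite !dprojMr -/(q u 1) quu'.
Qed.

(** Induction on length: equal heads are stripped by [comm_image_cons]; different heads are
    exchanged by commuting two single letters under [⊣]. *)
Lemma comm_image_perm u v : perm_eq u v -> q u 1 = q v 1.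
Proof.
have [n] := ubnP (size u); elim: n u v => // n IH [|x u] [|y v] //=.
- by move=> _ /perm_size.
- by move=> _ /perm_size.
rewrite ltnS => un puv; have [exy|nxy] := eqVneq x y.
  rewrite -{}exy perm_cons in puv *; case: u v un puv => [|a u] [|b v] // un puv.
  - by have := perm_size puv.
  - by have := perm_size puv.
  by apply: comm_image_cons => //; apply: IH.
have yu : y \in u.
  have : y \in x :: u by rewrite (perm_mem puv) mem_head.
  by rewrite inE eq_sym (negPf nxy).
have pu := perm_to_rem yu; set u' := rem y u in pu.
have su := perm_size pu.
have pv : perm_eq (x :: u') v.
  rewrite -(perm_cons y) -(permPr puv) perm_sym.
  apply: (@perm_trans _ ([:: x] ++ y :: u')); first by rewrite (perm_cat2l [:: x]).
  by rewrite (perm_catCA [:: x] [:: y] u').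
have sv := perm_size pv; rewrite /= in su sv.
(* With [u'] equal to [u] minus one [y], the chain is [x u], [x y u'], [y x u'], [y v]; the outer
   links use the induction hypothesis. *)
transitivity (q (x :: y :: u') 1).
  by apply: comm_image_cons; rewrite ?su //; apply: IH.
transitivity (q (y :: x :: u') 1); last first.
  by apply: comm_image_cons; rewrite -?sv //; apply: IH => //=; rewrite -su.
apply: (@comm_image_catr [:: x; y] [:: y; x] u') => //.
exact: (@comm_image_r [:: x] [:: y]).
Qed.

(** Cut just after the center and commute the two parts under [⊣], choosing center 1 in the second;
    it is nonempty because [m < size u]. *)
Lemma comm_image_rot u m : (0 < m < size u)%N -> q u m = q (rot m u) 1.
Proof.
move=> /andP[m0 mu]; rewrite -{1}[u](cat_take_drop m) /rot.
by apply: comm_image_r; rewrite ?size_drop ?subn_gt0 // size_takel ?m0 /= // ltnW.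
Qed.

(* Swapping the last letter to the front with the product |- leaves the center of
   the remaining factor free; placing it second makes comm_image_rot applicable. *)
Lemma comm_image_last u : (1 < size u)%N -> q u (size u) = q (rotr 1 u) 2.
Proof.
case/lastP: u => // u x; rewrite size_rcons rotr1_rcons => u0.
by rewrite -cats1 -addn1; apply: comm_image_l; rewrite ?u0.
Qed.

Lemma comm_image_nf d : q (word d) (center d) = q (word (nf d)) (center (nf d)).
Proof.
rewrite center_nf word_nf /nf_center.
have ps u : perm_eq u (word d) -> q u 1 = q (sortw (word d)) 1.
  by move=> pu; apply: comm_image_perm; rewrite (permPl pu) perm_sym perm_sortw.
have d0 := center_gt0 d; have := center_le d.
(* If the center is not on the last letter, a rotation brings it to 1 and sorting finishes; in
   length 2 it was already 1. *)
rewrite leq_eqVlt => /predU1P[dE|ds]; last first.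
  rewrite comm_image_rot ?d0 // ps ?perm_rot //.
  by case: ifP => // s2; congr q; lia.
have [s1|s1] := leqP (size (word d)) 1.
  by rewrite (leq_trans s1) //; congr q; case: (word d) s1 => [|x []].
(* The center is now on the last letter. In length 2 the letters can only be swapped with center 2
   kept; in greater length position 2 is not last, so rotation applies. *)
rewrite dE comm_image_last //; have [s2|s2] := leqP (size (word d)) 2.
  case: (word d) s1 s2 => [|x [|y []]] // _ _.
  have -> : rotr 1 [:: x; y] = [:: y; x] by [].
  have sort2 a b : (a <= b)%O -> sortw [:: a; b] = [:: a; b] :> seq X.
    by move=> ab; apply: sorted_sort; [exact: le_trans | rewrite /= ab].
  case/orP: (le_total x y) => [xy|yx].
    by rewrite sort2 //; apply: (@comm_image_l [:: y] [:: x] 1 1).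
  by rewrite (@sortw_perm _ _ _ [:: y; x]) ?sort2 // (perm_catC [:: x] [:: y]).
rewrite comm_image_rot ?size_rotr // ps //.
by rewrite perm_rot perm_rotr.
Qed.

Lemma Id_comm_sort : Id T = Id (sort_rel k X).
Proof.
apply/seteqP; split=> f If.
  apply/Id_sort_rel; apply: If (@ker_NF_ideal _ k X) _ => {}f.
  case=> d [e [|] ->]; rewrite /= !linearB /= ?dib_l ?dib_r !NF_dib.
    by rewrite nf_l_comm subrr.
  by rewrite nf_r_comm subrr.
apply: If (Id_ideal T) _ => s /sort_rel_nf[_ [d ->]].
by apply/dprojP; have := comm_image_nf d; rewrite /comm_image !dw_dib.
Qed.

End CommutativeIdeal.

(** * The basis of the free commutative dialgebra *)

Section Basis.
Context {disp : Order.disp_t} (k : fieldType) (X : orderType disp).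
Local Notation Di := (Di k X).
Local Notation T := (comm_rel k X).
Local Notation image d := (dproj T (dib d)).

Lemma dproj_NF (f : Di) : dproj T (NF f) = dproj T f.
Proof.
apply/dprojP; rewrite Id_comm_sort; apply/Id_sort_rel.
by rewrite linearB /= NF_id subrr.
Qed.

Lemma dproj_NF_eq (f g : Di) : dproj T f = dproj T g <-> NF f = NF g.
Proof.
split=> [/dprojP|fg]; last by rewrite -dproj_NF fg dproj_NF.
by rewrite Id_comm_sort => /Id_sort_rel; rewrite linearB => /subr0_eq.
Qed.

Fact dproj_linear : linear (dproj T).
Proof. by move=> c f g; rewrite dprojD dprojZ. Qed.
HB.instance Definition _ :=
  GRing.isLinear.Build k Di (dquot T) *:%R (dproj T) dproj_linear.

(** [is_basis] takes coefficients as a function of the vector, so coefficients of indices with the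
    same image must be collected. *)
Lemma span_undup (V : lmodType k) (I : eqType) (s : seq I) (a : I -> k) (b : I -> V) :
  \sum_(i <- s) a i *: b i =
  \sum_(v <- undup (map b s)) (\sum_(i <- s | b i == v) a i) *: v.
Proof.
under [RHS]eq_bigr => v _ do rewrite scaler_suml.
rewrite (exchange_big_dep xpredT) //= [LHS]big_seq [RHS]big_seq.
apply: eq_bigr => i si; under eq_bigl => v do rewrite eq_sym.
rewrite -big_filter filter_pred1_uniq ?undup_uniq ?mem_undup ?map_f //.
by rewrite big_seq1.
Qed.

Lemma comm_basis : quotient_basis T (sorted_1 X `|` sorted_22 X).
Proof.
split=> [d e /nf_fixed dB /nf_fixed eB|].
  by move=> /dproj_NF_eq; rewrite !NF_dib dB eB => /dib_inj.
split=> [r c r_uniq rB r0 v vr|q].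
  have /choice [d_ dP] : forall v : dquot T, exists d : diword X,
      v \in r -> nf d = d /\ image d = v.
    (* Outside [r] any diword will do; since [X] may be empty, one is taken from the membership of
       [v]. *)
    move=> u; have [ur|] := boolP (u \in r); last first.
      by have [d _ _] := rB _ vr; exists d.
    by have [d /nf_fixed dB <-] := rB _ ur; exists d.
  have : NF (\sum_(u <- r) c u *: dib (d_ u) : Di) = 0.
    transitivity (NF (0 : Di)); last exact: linear0.
    apply/dproj_NF_eq; rewrite linear_sum linear0 -[RHS]r0 [LHS]big_seq [RHS]big_seq.
    by apply: eq_bigr => u /dP [_ du]; rewrite linearZ /= du.
  (* On [r] the choice [d_] is injective, as [image] inverts it; the coefficient at [d_ v] therefore
     isolates [c v]. *)
  have coefE u : u \in r ->
      mcoeff (d_ v) (NF (c u *: dib (d_ u) : Di)) = c u * (u == v)%:R.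
    move=> ur; have [du iu] := dP u ur; have [_ iv] := dP v vr.
    rewrite linearZ /= NF_dib du mcoeffZ dib_coef.
    suff -> : (d_ u == d_ v) = (u == v) by [].
    by apply/eqP/eqP => [duv|->//]; rewrite -iu duv iv.
  rewrite linear_sum => /(congr1 (mcoeff (d_ v))).
  rewrite mcoeff0 (raddf_sum (mcoeff (d_ v))) big_seq.
  rewrite (eq_bigr _ coefE) -big_seq (bigD1_seq v) //= eqxx mulr1 big1 ?addr0 // => u /negPf->.
  by rewrite mulr0.
(* Spanning: [f] and [NF f] have the same image, and [NF f] involves only fixed points of [nf]. *)
elim/dquot_ind: q => f; rewrite -dproj_NF NF_sum linear_sum.
under eq_bigr => d _ do rewrite linearZ.
rewrite span_undup; set r := undup _.
exists r, (fun v => \sum_(d <- msupp f | image (nf d) == v) mcoeff d f).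
split=> // b; rewrite mem_undup => /mapP[d _ ->].
by exists (nf d) => //; apply/nf_fixed/nf_id.
Qed.

End Basis.

Theorem proposition5p3 (disp : Order.disp_t) (k : fieldType)
  (X : orderType disp) (wfX : well_founded (fun x y : X => (x < y)%O)) :
  [/\ Id (comm_rel k X) = Id (sort_rel k X),
      Groebner_Shirshov (sort_rel k X) &
      quotient_basis (comm_rel k X) (sorted_1 X `|` sorted_22 X)].
Proof.
by split; [exact: Id_comm_sort | exact: sort_rel_GS | exact: comm_basis].
Qed.
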